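(* Let $n \geq 4$ be an integer. For a Bruhat interval $I=[u,v] \subset S_n$ (with $u \leq v$), let $a(I)$ and $c(I)$ denote its number of atoms and its number of coatoms, respectively. Then $I$ maximizes $c(I)-a(I)$ among all Bruhat intervals of $S_n$ if and only if $c(I)=\lfloor n^2/4 \rfloor$ and $a(I)=n-1$.
   Context: The symmetric group $S_n$ is equipped with the (strong) Bruhat order: it is the partial order whose cover relations are $w \lessdot wt$ where $t$ is a transposition and $\ell(wt)=\ell(w)+1$, with $\ell$ the number of inversions. For $u \leq v$ in $S_n$, the Bruhat interval is $[u,v]=\{w \in S_n : u \leq w \leq v\}$. The atoms of $[u,v]$ are the elements $w$ with $u \lessdot w \leq v$, and the coatoms of $[u,v]$ are the elements $w$ with $u \leq w \lessdot v$. *)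

(* Defs.v *)
From mathcomp Require Import all_boot all_order all_algebra all_fingroup.

Set Implicit Arguments.
Unset Strict Implicit.
Unset Printing Implicit Defensive.

Import Order.TTheory GRing.Theory Num.Theory.

Section Bruhat.
Variable n : nat.
Implicit Types u v w : 'S_n.

Definition inversions w : {set 'I_n * 'I_n} :=
  [set p : 'I_n * 'I_n | (p.1 < p.2) && (w p.2 < w p.1)].

Definition perm_length w : nat := #|inversions w|.

(* In MathComp (s * t) x = t (s x), so the product "w t" of permutations
   composed from right to left, x |-> w (t x), is written (t * w)%g. *)
Definition bruhat_cover : rel 'S_n := fun w w' =>
  [exists i : 'I_n, exists j : 'I_n,
     (i != j) && (w' == (tperm i j * w)%g)]
  && (perm_length w' == (perm_length w).+1).

Definition bruhat_le : rel 'S_n := connect bruhat_cover.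

Definition atoms u v : {set 'S_n} :=
  [set w | bruhat_cover u w && bruhat_le w v].

Definition coatoms u v : {set 'S_n} :=
  [set w | bruhat_le u w && bruhat_cover w v].

(* The difference is taken in int: on nat it would be truncated. *)
Definition coatoms_minus_atoms u v : int :=
  ((#|coatoms u v|)%:Z - (#|atoms u v|)%:Z)%R.

Definition maximizes_coatoms_minus_atoms u v : Prop :=
  forall u' v' : 'S_n, bruhat_le u' v' ->
    (coatoms_minus_atoms u' v' <= coatoms_minus_atoms u v)%R.

End Bruhat.

(* Main.v *)
Require Import Defs.
From mathcomp Require Import all_boot all_order all_algebra all_fingroup.
From mathcomp Require Import zify.

(* Join positions i and j when multiplying u (resp. v) by the transposition
   (i j) gives an atom (resp. a coatom) of [u, v].  The coatom graph is
   triangle-free, since v is at least three steps above v (i k) when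
   v_i > v_j > v_k and i < j < k.  The two graphs have the same connected
   components: completing u < x < y to a diamond with a second middle element
   x' shows that the label of x < y joins positions connected by the labels of
   u < x and u < x', so by induction every label of every maximal chain lies
   within a component of the atom graph, and dually for coatoms.  A component
   with m vertices has at most m^2/4 coatom edges (Mantel) and at least m - 1
   atom edges, and m |-> floor(m^2/4) - (m - 1) is superadditive, strictly so
   when the total is at least 4.  The bound is attained by [1, v] with v the
   word h+1 ... n 1 ... h for h = ceil(n/2). *)

Set Implicit Arguments.
Unset Strict Implicit.
Unset Printing Implicit Defensive.

(** * Triangle-free graphs *)

Section Graph.
Variable T : finType.
Implicit Types (e g h : rel T) (S A : {set T}).

(** Ordered pairs are counted, so each edge of a symmetric relation counts twice. This is the source
    of the factors 2 in the bounds below. *)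
Definition arcs e S := \sum_(x in S) \sum_(y in S) (e x y : nat).

Lemma arcs0 e : arcs e set0 = 0.
Proof. exact: big_set0. Qed.

Lemma arcs_setU1 e S x : symmetric e -> irreflexive e -> x \notin S ->
  arcs e (x |: S) = arcs e S + 2 * \sum_(y in S) (e x y : nat).
Proof.
move=> sym irr xS; rewrite /arcs big_setU1 //= big_setU1 //= irr add0n.
under [X in _ + X = _]eq_bigr => z _ do rewrite big_setU1 //= sym.
by rewrite big_split /=; lia.
Qed.

Lemma arcs_setD e S A : symmetric e -> A \subset S ->
  (forall x y, x \in A -> y \in S :\: A -> e x y = false) ->
  arcs e S = arcs e A + arcs e (S :\: A).
Proof.
move=> sym AS noe; rewrite /arcs (big_setID A) /= (setIidPr AS).
congr (_ + _); apply: eq_bigr => x xP;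
  rewrite (big_setID A) /= (setIidPr AS) ?addn0.
  by rewrite [X in _ + X]big1 ?addn0 // => y yP; rewrite noe.
by rewrite [X in X + _]big1 // => y yP; rewrite sym noe.
Qed.

(** Induction by deleting both ends of an edge x y. No other vertex is adjacent to both ends, so at
    most m edges run to the m remaining vertices; with x y itself this is m + 1, exactly the growth
    of floor(m^2/4) from m to m + 2. *)
Lemma mantel e S : symmetric e -> irreflexive e ->
  (forall x y z, e x y -> e y z -> e x z -> False) ->
  arcs e S <= 2 * (#|S| ^ 2 %/ 4).
Proof.
move=> sym irr tri; have [k] := ubnP #|S|; elim: k S => // k IH S ltSk.
have [/exists_inP[x xS /exists_inP[y yS exy]]|none] :=
  boolP [exists x in S, [exists y in S, e x y]]; last first.
  rewrite /arcs big1 // => x xS; rewrite big1 // => y yS; case exy: (e x y) => //.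
  case/negP: none; apply/exists_inP; exists x => //.
  by apply/exists_inP; exists y.
have neq : y != x by apply: contraTneq exy => ->; rewrite irr.
pose S' := S :\ x :\ y.
have yS' : y \notin S' by rewrite !inE eqxx.
have xyS' : x \notin y |: S' by rewrite !inE eqxx eq_sym (negPf neq).
have SE : S = x |: (y |: S') by rewrite !setD1K // !inE neq.
have cS : #|S| = #|S'|.+2 by rewrite {1}SE !cardsU1 xyS' yS'.
have degxy : \sum_(z in S') (e x z : nat) + \sum_(z in S') (e y z : nat) <= #|S'|.
  rewrite -big_split /= -sum1_card; apply: leq_sum => z _.
  case exz: (e x z); case eyz: (e y z) => //.
  by case: (tri x y z exy eyz exz).
rewrite {1}SE !arcs_setU1 // big_setU1 //= exy cS.
have leS' : arcs e S' <= 2 * (#|S'| ^ 2 %/ 4) by apply: IH; lia.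
have -> : #|S'|.+2 ^ 2 %/ 4 = #|S'|.+1 + #|S'| ^ 2 %/ 4.
  by rewrite -divnMDl //; congr (_ %/ _); lia.
lia.
Qed.

Definition component e x : {set T} := [set y | connect e x y].

(** A connected graph on m vertices has at least m - 1 edges. A maximal subset of the component that
    contains x and satisfies the bound is closed under [e]: adding a neighbour costs one vertex and
    gains at least two arcs. Hence it is the whole component. *)
Lemma card_component_arcs e x : symmetric e -> irreflexive e ->
  2 * #|component e x| <= arcs e (component e x) + 2.
Proof.
move=> sym irr; set C := component e x.
pose ok (S : {set T}) := [&& x \in S, S \subset C & 2 * #|S| <= arcs e S + 2].
have ok1 : ok [set x].
  rewrite /ok set11 sub1set inE connect0 cards1 /=; lia.
have [S /maxsetP[/and3P[xS SC leS] maxS] _] := maxset_exists ok1.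
suff -> : C = S by [].
apply/eqP; rewrite eqEsubset SC andbT.
suff clS : closed e (mem S).
  by apply/subsetP => y; rewrite inE => xy; rewrite -(closed_connect clS xy).
apply: intro_closed; first exact: sym_connect_sym sym.
move=> y z eyz yS; apply: contraT => zS.
suff okz : ok (z |: S).
  by case/negP: zS; rewrite -(maxS _ okz (subsetUr _ _)) setU11.
rewrite /ok setU1r // subUset SC sub1set inE arcs_setU1 // cardsU1 zS andbT /=.
have yC := subsetP SC _ yS; rewrite inE in yC.
rewrite (connect_trans yC (connect1 eyz)) /=.
by rewrite (big_setD1 y) //= sym eyz; lia.
Qed.

(** Strict superadditivity of floor(m^2/4) - (m - 1), with the strictness encoded as a boolean
    summand. If ab >= 4, the cross term 2ab/4 is already at least 2; otherwise only finitely many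
    pairs remain. *)
Lemma quarter_square_add a b : 0 < a -> 0 < b ->
  a ^ 2 %/ 4 + b ^ 2 %/ 4 + 1 + (4 <= a + b) <= (a + b) ^ 2 %/ 4.
Proof.
have [ab4|] := leqP 4 (a * b).
  by move=> a0 b0; rewrite leq_divRL // (sqrnD a b); lia.
case: a => [|[|[|[|a]]]]; case: b => [|[|[|[|b]]]] //; nia.
Qed.

(** * Two graphs with the same components: [g] for coatoms, [h] for atoms *)

Section SameComponents.
Variables g h : rel T.
Hypotheses (g_sym : symmetric g) (g_irr : irreflexive g).
Hypotheses (h_sym : symmetric h) (h_irr : irreflexive h).
Hypothesis g_tri : forall x y z, g x y -> g y z -> g x z -> False.
Hypothesis gh : connect g =2 connect h.

Let csym : connect_sym h.
Proof. exact: sym_connect_sym h_sym. Qed.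

(** By [gh], no edge of either graph leaves a component of [h], so both arc counts split. The rest
    of S stays closed, which lets an induction peel off components one by one. *)
Lemma arcs_split_component S x : closed h (mem S) -> x \in S ->
  let C := component h x in
  [/\ C \subset S, closed h (mem (S :\: C)),
      arcs g S = arcs g C + arcs g (S :\: C) &
      arcs h S = arcs h C + arcs h (S :\: C)].
Proof.
move=> clS xS C.
have CS : C \subset S.
  by apply/subsetP => y; rewrite inE => xy; rewrite -(closed_connect clS xy).
have sep y z : y \in C -> z \in S :\: C -> connect h y z -> False.
  rewrite !inE => xy /andP[/negP nxz _] yz.
  by apply: nxz; apply: connect_trans xy yz.
split=> //.
- apply: intro_closed => // y z yz; rewrite !inE => /andP[nxy yS].
  rewrite -(clS _ _ yz) yS andbT; apply: contra nxy => xz.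
  by apply: connect_trans xz _; rewrite csym connect1.
- apply: arcs_setD => // y z yC zC; apply/negP => yz.
  by apply: sep yC zC _; rewrite -gh connect1.
- apply: arcs_setD => // y z yC zC; apply/negP => yz.
  by apply: sep yC zC _; rewrite connect1.
Qed.

(** On each component [mantel] bounds [g] from above and [card_component_arcs] bounds [h] from
    below; [quarter_square_add] adds up the components. *)
Lemma arcs_closed_bound S : closed h (mem S) -> S != set0 ->
  arcs g S + 2 * #|S| <= arcs h S + 2 * (#|S| ^ 2 %/ 4) + 2.
Proof.
have [k] := ubnP #|S|; elim: k S => // k IH S ltSk clS /set0Pn[x xS].
have [CS clD -> ->] := arcs_split_component clS xS.
set C := component h x in CS clD *.
have C0 : 0 < #|C| by apply/card_gt0P; exists x; rewrite inE connect0.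
have hC := card_component_arcs x h_sym h_irr; rewrite -/C in hC.
have gC := @mantel g C g_sym g_irr g_tri.
have cS : #|S| = #|C| + #|S :\: C| by rewrite -(cardsID C S) (setIidPr CS).
have [D0|D0] := eqVneq (S :\: C) set0.
  by rewrite cS D0 !arcs0 cards0; lia.
have Dpos : 0 < #|S :\: C| by rewrite card_gt0.
have ltDk : #|S :\: C| < k by lia.
have {}IH := IH _ ltDk clD D0.
have := quarter_square_add C0 Dpos; rewrite -cS; lia.
Qed.

(** The first alternative is the disconnected case, where superadditivity is strict since there are
    at least 4 vertices. The second is the connected case, where the two bounds hold separately. *)
Lemma arcs_bound_or_extremal : 4 <= #|T| ->
  arcs g setT + 2 * #|T| < arcs h setT + 2 * (#|T| ^ 2 %/ 4) + 2 \/
  arcs g setT <= 2 * (#|T| ^ 2 %/ 4) /\ 2 * #|T| <= arcs h setT + 2.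
Proof.
move=> T4; have /card_gt0P[x _] : 0 < #|T| by lia.
have clT : closed h (mem [set: T]) by move=> y z _; rewrite !inE.
have [CS clD gE hE] := arcs_split_component clT (in_setT x).
set C := component h x in CS clD gE hE.
have hC := card_component_arcs x h_sym h_irr; rewrite -/C in hC.
have gC := @mantel g C g_sym g_irr g_tri.
have [D0|D0] := eqVneq (setT :\: C) set0.
  right; have CT : C = setT by apply/eqP; rewrite eqEsubset CS -setD_eq0 D0 eqxx.
  by rewrite CT cardsT in hC gC; split.
left; have gD := arcs_closed_bound clD D0.
have cS : #|T| = #|C| + #|setT :\: C| by rewrite -cardsT -(cardsID C setT) (setIidPr CS).
have C0 : 0 < #|C| by apply/card_gt0P; exists x; rewrite inE connect0.
have Dpos : 0 < #|setT :\: C| by rewrite card_gt0.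
have := quarter_square_add C0 Dpos; rewrite -cS T4 gE hE; lia.
Qed.

End SameComponents.
End Graph.

(** * Length and covers *)

Section Length.
Variable n : nat.
Implicit Types (w u v x y : 'S_n) (i j k l a b c d : 'I_n).

(* An involution on the pairs p with p.1 < p.2.  It maps the inversions of w
   injectively to those of tperm i j * w other than (i, j) when w i < w j, and
   conversely if no point (k, w k) lies strictly between (i, w i) and
   (j, w j). *)
Definition sort_swap i j (p : 'I_n * 'I_n) :=
  if tperm i j p.1 < tperm i j p.2 then (tperm i j p.1, tperm i j p.2) else p.

Lemma sort_swap_inj i j :
  {in [pred p : 'I_n * 'I_n | p.1 < p.2] &, injective (sort_swap i j)}.
Proof.
have K : {in [pred p : 'I_n * 'I_n | p.1 < p.2],
           cancel (sort_swap i j) (sort_swap i j)}.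
  move=> [a b]; rewrite inE /= => ab; rewrite /sort_swap /=.
  by case h: (tperm i j a < tperm i j b) => /=; rewrite ?tpermK ?ab ?h.
by move=> p q hp hq e; rewrite -(K p) // e K.
Qed.

(** The second alternative lists the pairs on which [sort_swap] takes its default branch; there the
    inversions must be compared directly. *)
Lemma tperm_ltn_cases (i j a b : 'I_n) : i < j -> a < b ->
  tperm i j a < tperm i j b \/
  [/\ tperm i j b <= tperm i j a &
   [\/ a = i /\ b = j, [/\ a = i, b != i, b != j & b < j] |
       [/\ b = j, a != i, a != j & i < a]]].
Proof.
move=> ij ab; have [h|h] := ltnP (tperm i j a) (tperm i j b); first by left.
right; split=> //; move: h.
case: tpermP => [bi|bj|/eqP bi /eqP bj]; case: tpermP => [ai|aj|/eqP ai /eqP aj];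
  subst; try (by rewrite ltnn in ab).
- lia.
- lia.
- by move=> _; constructor 1.
- by move=> ?; constructor 3; split=> //; rewrite ltn_neqAle eq_sym ai.
- by move=> ?; constructor 2; split=> //; rewrite ltn_neqAle bj.
- lia.
- lia.
Qed.

Lemma length_tperm_lt w i j : i < j -> w i < w j ->
  perm_length w < perm_length (tperm i j * w)%g.
Proof.
move=> ij wij; rewrite /perm_length.
rewrite -(card_in_imset (f := sort_swap i j) (D := mem (inversions w))); last first.
  move=> p q; rewrite !inE => /andP[hp _] /andP[hq _]; exact: sort_swap_inj.
apply: proper_card; apply/properP; split.
  apply/subsetP => _ /imsetP[[a b] abw ->]; move: abw.
  rewrite !inE /sort_swap /= !permM => /andP[ab wab].
  case: (tperm_ltn_cases ij ab) => [h|[h c]]; first by rewrite h /= h !tpermK.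
  rewrite (ltnNge (tperm i j a)) h /= ab /=; case: c => [[? ?]|[? bi bj bltj]|[? ai aj alti]]; subst.
  - by lia.
  - by rewrite tpermL tpermD 1?eq_sym //; lia.
  - by rewrite tpermR tpermD 1?eq_sym //; lia.
(* The pair (i, j) has no preimage: a swapped one would be (j, i), which is not increasing, and an
   unswapped one would be (i, j), which is not an inversion of [w]. *)
exists (i, j); first by rewrite !inE /= !permM tpermL tpermR ij.
apply/negP => /imsetP[[a b]]; rewrite !inE /= /sort_swap /= => /andP[ab wab].
case: ifP => h [ei ej].
  by move: ab; rewrite -(tpermK i j a) -(tpermK i j b) -ei -ej tpermL tpermR; lia.
by move: wab; rewrite -ei -ej; lia.
Qed.

Lemma length_tperm_cover w i j : i < j -> w i < w j ->
  (forall k, i < k -> k < j -> w i < w k -> w k < w j -> False) ->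
  perm_length (tperm i j * w)%g = (perm_length w).+1.
Proof.
move=> ij wij nok; apply/eqP; rewrite eqn_leq length_tperm_lt // andbT.
rewrite /perm_length (cardsD1 (i, j)) (_ : (i, j) \in _); last first.
  by rewrite inE /= !permM tpermL tpermR ij.
rewrite ltnS.
rewrite -(card_in_imset (f := sort_swap i j)); last first.
  move=> p q; rewrite !inE => /and3P[_ hp _] /and3P[_ hq _]; exact: sort_swap_inj.
apply: subset_leq_card.
apply/subsetP => _ /imsetP[[a b] abw ->]; move: abw.
rewrite !inE /sort_swap /= !permM => /and3P[nij ab wab].
case: (tperm_ltn_cases ij ab) => [h|[h c]]; first by rewrite h /= h.
rewrite (ltnNge (tperm i j a)) h /= ab /=.
(* If an unswapped pair (i, b) or (a, j) were not an inversion of [w], then b or a would give a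
   point strictly between those at i and j. *)
case: c => [[? ?]|[? bi bj bltj]|[? ai aj alti]]; subst.
- by rewrite eqxx in nij.
- move: wab; rewrite tpermL tpermD 1?eq_sym // => wb.
  rewrite ltnNge leq_eqVlt; apply/negP => /orP[/eqP/val_inj/perm_inj e|lt].
    by rewrite e eqxx in bi.
  exact: (nok b).
- move: wab; rewrite tpermR tpermD 1?eq_sym // => wb.
  rewrite ltnNge leq_eqVlt; apply/negP => /orP[/eqP/val_inj/perm_inj e|lt].
    by rewrite e eqxx in aj.
  exact: (nok a).
Qed.

Lemma cover_tperm w i j : i != j ->
  bruhat_cover w (tperm i j * w)%g =
  (perm_length (tperm i j * w)%g == (perm_length w).+1).
Proof.
move=> ij; rewrite /bruhat_cover; case: eqP => //= _; rewrite ?andbT ?andbF //.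
by apply/existsP; exists i; apply/existsP; exists j; rewrite ij eqxx.
Qed.

Lemma coverP u x : bruhat_cover u x ->
  exists i j, [/\ i < j, u i < u j, x = (tperm i j * u)%g &
                  perm_length x = (perm_length u).+1].
Proof.
case/andP => /existsP[i /existsP[j /andP[ij /eqP ->]]] /eqP len.
wlog lij : i j ij len / i < j => [W|].
  have [lt|gt|e] := ltngtP i j; first exact: W.
    by rewrite tpermC; apply: W; rewrite 1?eq_sym 1?tpermC.
  by rewrite (val_inj e) eqxx in ij.
exists i, j; split=> //; rewrite ltnNge leq_eqVlt.
apply/negP => /orP[/eqP/val_inj/perm_inj e|lt]; first by rewrite e eqxx in ij.
have := @length_tperm_lt (tperm i j * u)%g i j lij.
rewrite !permM tpermL tpermR tpermKg => /(_ lt); lia.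
Qed.

Lemma cover_tpermP u i j : i < j -> bruhat_cover u (tperm i j * u)%g ->
  u i < u j /\ perm_length (tperm i j * u)%g = (perm_length u).+1.
Proof.
move=> ij; have nij : i != j by apply: contraTneq ij => ->; rewrite ltnn.
rewrite cover_tperm // => /eqP len; split=> //; rewrite ltnNge leq_eqVlt.
apply/negP => /orP[/eqP/val_inj/perm_inj e|lt]; first by rewrite e eqxx in nij.
have := @length_tperm_lt (tperm i j * u)%g i j ij.
rewrite !permM tpermL tpermR tpermKg => /(_ lt); lia.
Qed.


Lemma ltn_ord_neq i j : i < j -> (i != j) * (j != i).
Proof. by rewrite -!val_eqE /= => ij; split; lia. Qed.

Lemma tperm_mid i j k : i < j -> j < k ->
  (tperm i k = tperm j k * (tperm i j * tperm j k))%g.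
Proof.
move=> ij jk; have <- : (tperm i j ^ tperm j k = tperm i k)%g.
  by rewrite tpermJ tpermL tpermD ?(ltn_ord_neq ij) ?(ltn_ord_neq (ltn_trans ij jk)).
by rewrite conjgE tpermV.
Qed.

(** Factor (i k) as (j k)(i j)(j k) by [tperm_mid]; each of the three factors, applied in turn,
    raises the length. *)
Lemma length_tperm_mid w i j k : i < j -> j < k -> w i < w j -> w j < w k ->
  (perm_length w).+3 <= perm_length (tperm i k * w)%g.
Proof.
move=> ij jk wij wjk; have ik := ltn_trans ij jk.
have [nij nji] := ltn_ord_neq ij; have [njk nkj] := ltn_ord_neq jk.
have [nik nki] := ltn_ord_neq ik.
rewrite (tperm_mid ij jk) -!mulgA.
have l1 := length_tperm_lt jk wjk.
set w1 := (tperm j k * w)%g in l1 *.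
have l2 : perm_length w1 < perm_length (tperm i j * w1)%g.
  apply: length_tperm_lt => //; rewrite !permM tpermL tpermD //.
  exact: ltn_trans wjk.
set w2 := (tperm i j * w1)%g in l2 *.
have l3 : perm_length w2 < perm_length (tperm j k * w2)%g.
  apply: length_tperm_lt => //; rewrite !permM tpermR (tpermD nik njk).
  by rewrite tpermR tpermD.
exact: leq_ltn_trans (leq_ltn_trans l1 l2) l3.
Qed.

(** * Completing chains of length two to diamonds *)

Lemma diamond_mid u a b c d y : a < b -> u a < u b ->
  y = (tperm c d * (tperm a b * u))%g ->
  c < d -> (tperm a b * u)%g c < (tperm a b * u)%g d ->
  perm_length y = (perm_length u).+2 ->
  bruhat_cover u (tperm a b * u)%g /\ bruhat_cover (tperm a b * u)%g y.
Proof.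
move=> ab uab -> cd xcd len.
have [nab _] := ltn_ord_neq ab; have [ncd _] := ltn_ord_neq cd.
have l1 := length_tperm_lt ab uab; have l2 := length_tperm_lt cd xcd.
(* Both steps raise the length and the total rise is two, so each rise is exactly one. *)
by rewrite !cover_tperm //; split; lia.
Qed.

(* The two alternatives are the two ways of moving one transposition past the
   other by conjugation; they coincide when the supports are disjoint. *)
Lemma diamond u i j k l : i < j -> k < l ->
  let x := (tperm i j * u)%g in let y := (tperm k l * x)%g in
  bruhat_cover u x -> bruhat_cover x y ->
  (exists a b, [/\ a = tperm i j k, b = tperm i j l,
     bruhat_cover u (tperm a b * u)%g, bruhat_cover (tperm a b * u)%g y &
     y = (tperm i j * (tperm a b * u))%g]) \/
  (exists c d, [/\ c = tperm k l i, d = tperm k l j,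
     bruhat_cover u (tperm k l * u)%g, bruhat_cover (tperm k l * u)%g y &
     y = (tperm c d * (tperm k l * u))%g]).
Proof.
move=> ij kl x y /(cover_tpermP ij)[uij lx] /(cover_tpermP kl)[xkl ly].
have len : perm_length y = (perm_length u).+2 by rewrite ly lx.
have [nij nji] := ltn_ord_neq ij; have [nkl nlk] := ltn_ord_neq kl.
have left_case : tperm i j k < tperm i j l ->
    (tperm (tperm i j k) (tperm i j l) * u)%g i <
      (tperm (tperm i j k) (tperm i j l) * u)%g j ->
    exists a b, [/\ a = tperm i j k, b = tperm i j l,
     bruhat_cover u (tperm a b * u)%g, bruhat_cover (tperm a b * u)%g y &
     y = (tperm i j * (tperm a b * u))%g].
  move=> lt1 lt2; exists (tperm i j k), (tperm i j l).
  have yE : y = (tperm i j * (tperm (tperm i j k) (tperm i j l) * u))%g.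
    by rewrite /y /x -(tpermJ k l) conjgE tpermV !mulgA tperm2 mul1g.
  by move: xkl; rewrite !permM => xkl; have [] := diamond_mid lt1 xkl yE ij lt2 len.
have right_case : u k < u l -> tperm k l i < tperm k l j ->
    exists c d, [/\ c = tperm k l i, d = tperm k l j,
     bruhat_cover u (tperm k l * u)%g, bruhat_cover (tperm k l * u)%g y &
     y = (tperm c d * (tperm k l * u))%g].
  move=> lt1 lt2; exists (tperm k l i), (tperm k l j).
  have yE : y = (tperm (tperm k l i) (tperm k l j) * (tperm k l * u))%g.
    by rewrite /y /x -(tpermJ i j) conjgE tpermV -!mulgA tpermKg.
  have lt3 : (tperm k l * u)%g (tperm k l i) < (tperm k l * u)%g (tperm k l j).
    by rewrite !permM !tpermK.
  by have [] := diamond_mid kl lt1 yE lt2 lt3 len.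
move: xkl left_case right_case; rewrite !permM.
have neq_u a b : a != b -> u b < u a \/ u a < u b.
  move=> nab; case: (ltngtP (u a) (u b)) => [?|?|/val_inj/perm_inj e]; try by auto.
  by rewrite e eqxx in nab.
(* Cases on how {k, l} meets {i, j}. The choice of alternative is decided by comparing positions
   when k = i or l = j, and values of [u] when k = j or l = i; disjoint supports commute. *)
have [eki | nki] := eqVneq k i.
  subst k; have [elj | nlj] := eqVneq l j.
    by move: len; rewrite /y /x elj tpermKg; lia.
  have [jl|lj] : j < l \/ l < j by case: (ltngtP j l) => [?|?|/val_inj e]; auto; rewrite e eqxx in nlj.
    rewrite !tpermL !(tpermD nkl) // 1?eq_sym // => ujl lft _; left; apply: lft => //.
    by rewrite tpermD //; apply: ltn_trans ujl.
  rewrite !tpermL !(tpermD nkl) // 1?eq_sym // => ujl _; rewrite (tpermD nij) //.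
  by move=> rgt; right; apply: rgt => //; apply: ltn_trans ujl.
have [ekj | nkj] := eqVneq k j.
  subst k; have nil : i != l by case/ltn_ord_neq: (ltn_trans ij kl).
  rewrite !tpermR !(tpermD nil nkl) => uil; rewrite (tpermD nij) // !tpermL.
  rewrite [tperm j l i]tpermD 1?eq_sym // => lft rgt.
  have [ulj|ujl] := neq_u _ _ nkl.
    by left; apply: lft => //; apply: ltn_trans kl.
  by right; apply: rgt => //; apply: ltn_trans kl.
have [elj | nlj] := eqVneq l j.
  subst l; rewrite !tpermR !(tpermD _ _ : tperm i j k = k) 1?eq_sym //.
  move=> uki lft rgt.
  have [ik|ki] : i < k \/ k < i by case: (ltngtP i k) => [?|?|/val_inj e]; auto; rewrite e eqxx in nki.
    right; apply: rgt; first exact: ltn_trans uij.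
    by rewrite tpermD //.
  left; apply: lft => //; rewrite tpermD // 1?eq_sym //; exact: ltn_trans uij.
have [eli | nli] := eqVneq l i.
  subst l; rewrite !tpermL !(tpermD _ _ : tperm i j k = k) 1?eq_sym //.
  rewrite !tpermR => ukj lft rgt.
  have [uik|uki] := neq_u _ _ nkl.
    left; apply: lft; first exact: ltn_trans ij.
    by rewrite (tpermD nki nji).
  right; apply: rgt => //; rewrite tpermD //; exact: ltn_trans ij.
rewrite !(tpermD _ _ : tperm i j k = k) 1?eq_sym //.
rewrite !(tpermD _ _ : tperm i j l = l) 1?eq_sym //.
by move=> ukl _ rgt; right; apply: rgt; rewrite // !tpermD.
Qed.

(** * Atom and coatom graphs *)

Definition atom_edge u v : rel 'I_n :=
  fun i j => (i != j) && ((tperm i j * u)%g \in atoms u v).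
Definition coatom_edge u v : rel 'I_n :=
  fun i j => (i != j) && ((tperm i j * v)%g \in coatoms u v).

Lemma atom_edge_sym u v : symmetric (atom_edge u v).
Proof. by move=> i j; rewrite /atom_edge tpermC eq_sym. Qed.

Lemma coatom_edge_sym u v : symmetric (coatom_edge u v).
Proof. by move=> i j; rewrite /coatom_edge tpermC eq_sym. Qed.

Lemma atom_edge_irr u v : irreflexive (atom_edge u v).
Proof. by move=> i; rewrite /atom_edge eqxx. Qed.

Lemma coatom_edge_irr u v : irreflexive (coatom_edge u v).
Proof. by move=> i; rewrite /coatom_edge eqxx. Qed.

Lemma connect_tperm (e : rel 'I_n) i j k :
  symmetric e -> connect e i j -> connect e k (tperm i j k).
Proof.
move=> sym ij; case: tpermP => [->|->|_ _] //.
by rewrite (sym_connect_sym sym).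
Qed.

Lemma cover_ltn_wlog (P : 'I_n -> 'I_n -> Prop) :
  (forall i j, P i j -> P j i) -> (forall i j, i < j -> P i j) ->
  forall i j, i != j -> P i j.
Proof.
move=> sym lt i j nij; have [h|h|h] := ltngtP i j; [exact: lt|exact/sym/lt|].
by rewrite (val_inj h) eqxx in nij.
Qed.

(** In one alternative of [diamond], (k l) is itself an atom label. In the other, (i j) and the
    conjugate of (k l) by (i j) are atom labels, and moving k and l by (i j) stays within their
    components. *)
Lemma atom_edge_step u v i j k l : i < j -> k != l ->
  let x := (tperm i j * u)%g in let y := (tperm k l * x)%g in
  bruhat_cover u x -> bruhat_cover x y -> bruhat_le y v ->
  connect (atom_edge u v) k l.
Proof.
move=> ij kl; have [nij _] := ltn_ord_neq ij; have sym := @atom_edge_sym u v.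
elim/cover_ltn_wlog: k l / kl => [k l|k l kl] /=.
  by rewrite (tpermC l k) => IH *; rewrite (sym_connect_sym sym) IH.
set x := (tperm i j * u)%g; set y := (tperm k l * x)%g => ux xy yv.
have e1 : atom_edge u v i j.
  rewrite /atom_edge nij inE ux; exact: connect_trans (connect1 xy) yv.
have [[a [b [-> -> ux' x'y _]]]|[c [d [_ _ ux' x'y _]]]] := diamond ij kl ux xy; last first.
  apply: connect1; rewrite /atom_edge inE ux' (ltn_ord_neq kl) /=.
  exact: connect_trans (connect1 x'y) yv.
have e2 : atom_edge u v (tperm i j k) (tperm i j l).
  rewrite /atom_edge inE ux' (inj_eq perm_inj) (ltn_ord_neq kl) /=.
  exact: connect_trans (connect1 x'y) yv.
apply: connect_trans (connect_tperm k sym (connect1 e1)) _.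
apply: connect_trans (connect1 e2) _.
by rewrite (sym_connect_sym sym) connect_tperm ?connect1.
Qed.

Lemma coatom_edge_step u x i j k l : i != j -> k < l ->
  let y := (tperm i j * x)%g in let v := (tperm k l * y)%g in
  bruhat_le u x -> bruhat_cover x y -> bruhat_cover y v ->
  connect (coatom_edge u v) i j.
Proof.
move=> ij kl; have [nkl _] := ltn_ord_neq kl.
elim/cover_ltn_wlog: i j / ij => [i j|i j ij] /=.
  by rewrite (tpermC j i) => IH *; rewrite (sym_connect_sym (@coatom_edge_sym _ _)) IH.
set y := (tperm i j * x)%g; set v := (tperm k l * y)%g => ux xy yv.
have sym := @coatom_edge_sym u v.
have e1 : coatom_edge u v k l.
  rewrite /coatom_edge nkl inE tpermKg yv andbT.
  exact: connect_trans ux (connect1 xy).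
have [[a [b [_ _ xx' x'v vE]]]|[c [d [-> -> xx' x'v vE]]]] := diamond ij kl xy yv.
  apply: connect1; rewrite /coatom_edge inE (ltn_ord_neq ij) /=.
  rewrite {1 2}/v {1 2}/y vE tpermKg x'v andbT.
  exact: connect_trans ux (connect1 xx').
have e2 : coatom_edge u v (tperm k l i) (tperm k l j).
  rewrite /coatom_edge inE (inj_eq perm_inj) (ltn_ord_neq ij) /=.
  rewrite {1 2}/v {1 2}/y vE tpermKg x'v andbT.
  exact: connect_trans ux (connect1 xx').
apply: connect_trans (connect_tperm i sym (connect1 e1)) _.
apply: connect_trans (connect1 e2) _.
by rewrite (sym_connect_sym sym) connect_tperm ?connect1.
Qed.

(** Induction on the chain from u to x: if x1 is its first step, [atom_edge_step] turns each atom
    edge of [x1, v] into a path of atom edges of [u, v]. *)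
Lemma chain_label_atoms u v x k l : k != l ->
  bruhat_le u x -> bruhat_cover x (tperm k l * x)%g ->
  bruhat_le (tperm k l * x)%g v -> connect (atom_edge u v) k l.
Proof.
move=> kl /connectP[p]; elim: p u => [|x1 p IH] u /= => [_ ->|/andP[ux1 px] xE] cx lv.
  by apply: connect1; rewrite /atom_edge kl inE cx.
apply: connect_sub (IH x1 px xE cx lv) => a b /andP[ab]; rewrite inE => /andP[cab leab].
have [i [j [ij _ x1E _]]] := coverP ux1; subst x1.
exact: atom_edge_step ij ab ux1 cab leab.
Qed.

Lemma chain_label_coatoms u v x i j : i != j ->
  bruhat_le u x -> bruhat_cover x (tperm i j * x)%g ->
  bruhat_le (tperm i j * x)%g v -> connect (coatom_edge u v) i j.
Proof.
move=> ij ux cx /connectP[p]; elim/last_ind: p v => [|p v' IH] v /=.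
  by move=> _ ->; apply: connect1; rewrite /coatom_edge ij inE tpermKg ux cx.
rewrite rcons_path last_rcons => /andP[px yv] ?; subst v'.
apply: connect_sub (IH _ px erefl) => a b /andP[ab]; rewrite inE => /andP[leab cab].
set w := last _ _ in yv leab cab.
have [k [l [kl _ vE _]]] := coverP yv; subst v.
have := @coatom_edge_step u (tperm a b * w)%g a b k l ab kl.
by rewrite /= tpermKg; apply.
Qed.

(** A coatom edge labels the last step of a maximal chain of [u, v] and an atom edge labels the
    first, so the two chain label lemmas apply to them. *)
Lemma connect_coatom_atom u v : connect (coatom_edge u v) =2 connect (atom_edge u v).
Proof.
move=> a b; apply/idP/idP; move: a b; apply: connect_sub => i j /andP[ij];
  rewrite inE => /andP[].
  move=> le cov; apply: (@chain_label_atoms u v (tperm i j * v)%g) => //.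
    by rewrite tpermKg.
  by rewrite tpermKg; apply: connect0.
by move=> cov le; apply: (@chain_label_coatoms u v u) => //; apply: connect0.
Qed.

Lemma coatom_edge_triangle u v (x y z : 'I_n) :
  coatom_edge u v x y -> coatom_edge u v y z -> coatom_edge u v x z -> False.
Proof.
have sym := @coatom_edge_sym u v.
have sorted a b c : a < b -> b < c -> coatom_edge u v a b ->
    coatom_edge u v b c -> coatom_edge u v a c -> False.
  have cov i j : i < j -> coatom_edge u v i j ->
      v j < v i /\ perm_length v = (perm_length (tperm i j * v)%g).+1.
    move=> ij /andP[_]; rewrite inE => /andP[_].
    have := @cover_tpermP (tperm i j * v)%g i j ij; rewrite tpermKg.
    by move=> h /h; rewrite !permM tpermL tpermR.
  move=> ab bc /(cov _ _ ab)[vba _] /(cov _ _ bc)[vcb _].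
  have ac := ltn_trans ab bc; move=> /(cov _ _ ac)[vca len].
  have := @length_tperm_mid (tperm a c * v)%g a b c ab bc.
  rewrite !permM tpermL tpermR tpermKg tpermD ?(ltn_ord_neq ab) ?(ltn_ord_neq bc) //.
  by move=> /(_ vcb vba); lia.
move=> exy eyz exz; have eyx : coatom_edge u v y x by rewrite sym.
have ezy : coatom_edge u v z y by rewrite sym.
have ezx : coatom_edge u v z x by rewrite sym.
have neq i j : coatom_edge u v i j -> i < j \/ j < i.
  case/andP => nij _; case: (ltngtP i j) => [?|?|/val_inj e]; auto.
  by rewrite e eqxx in nij.
(* Of the eight sign patterns two are cyclic, hence impossible; the other six are the orderings of
   x, y, z. *)
have [xy|yx] := neq _ _ exy; have [yz|zy] := neq _ _ eyz; have [xz|zx] := neq _ _ exz;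
  first [lia | exact: (sorted x y z) | exact: (sorted x z y) | exact: (sorted y x z)
        |exact: (sorted y z x) | exact: (sorted z x y) | exact: (sorted z y x)].
Qed.


(** * Counting atoms and coatoms by edges *)

Lemma tperm_inj_ltn i j k l : i < j -> k < l -> tperm i j = tperm k l ->
  (i, j) = (k, l).
Proof.
move=> ij kl e; have := tpermL i j; rewrite e.
case: tpermP => [-> -> //|eil ekj|_ _ eij]; first by subst; lia.
by rewrite eij ltnn in ij.
Qed.

Lemma card_tperm_multiples w (X : {set 'S_n}) :
  (forall z, z \in X -> exists i j, i < j /\ z = (tperm i j * w)%g) ->
  #|[set p : 'I_n * 'I_n | (p.1 < p.2) && ((tperm p.1 p.2 * w)%g \in X)]| = #|X|.
Proof.
move=> XP; set E := [set p | _].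
have -> : X = [set (tperm p.1 p.2 * w)%g | p : 'I_n * 'I_n in E].
  apply/setP => z; apply/idP/imsetP => [zX|[p]]; last first.
    by rewrite inE => /andP[_ pX] ->.
  have [i [j [ij zE]]] := XP z zX; exists (i, j) => //.
  by rewrite inE /= ij -zE.
rewrite card_in_imset // => -[i j] [k l]; rewrite !inE /= => /andP[ij _] /andP[kl _].
by move/mulIg/(tperm_inj_ltn ij kl).
Qed.

Lemma arcs_tperm_multiples w (X : {set 'S_n}) :
  (forall z, z \in X -> exists i j, i < j /\ z = (tperm i j * w)%g) ->
  arcs (fun i j => (i != j) && ((tperm i j * w)%g \in X)) setT = 2 * #|X|.
Proof.
move=> XP; rewrite -(card_tperm_multiples XP).
set F := fun i j => ((i < j) && ((tperm i j * w)%g \in X) : nat).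
have -> : #|[set p : 'I_n * 'I_n | (p.1 < p.2) && ((tperm p.1 p.2 * w)%g \in X)]|
         = \sum_i \sum_j F i j.
  rewrite -sum1_card pair_big /= [LHS]big_mkcond /=.
  by apply: eq_bigr => p _; rewrite inE /F; case: (_ && _).
(* One copy of the sum counts the arcs with i < j, the exchanged copy those with j < i. *)
rewrite mul2n -addnn {2}exchange_big -big_split /arcs /=.
apply: eq_big => [i|i _]; first by rewrite inE.
rewrite -big_split /=; apply: eq_big => [j|j _]; first by rewrite inE.
rewrite /F (tpermC j i) -val_eqE neq_ltn /=.
by case: ltngtP => // _; rewrite addn0.
Qed.

Lemma arcs_atom_edge u v : arcs (atom_edge u v) setT = 2 * #|atoms u v|.
Proof.
apply: arcs_tperm_multiples => z; rewrite inE => /andP[/coverP[i [j [ij _ -> _]]] _].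
by exists i, j.
Qed.

Lemma arcs_coatom_edge u v : arcs (coatom_edge u v) setT = 2 * #|coatoms u v|.
Proof.
apply: arcs_tperm_multiples => z; rewrite inE => /andP[_ /coverP[i [j [ij _ -> _]]]].
by exists i, j; rewrite tpermKg.
Qed.

(** Written without subtraction. The first alternative says that the difference is strictly below
    floor(n^2/4) - (n - 1), so an interval reaching this value falls under the second, where both
    inequalities are then equalities. *)
Lemma coatoms_atoms_bound u v : 4 <= n ->
  #|coatoms u v| + n < #|atoms u v| + n ^ 2 %/ 4 + 1 \/
  #|coatoms u v| <= n ^ 2 %/ 4 /\ n <= #|atoms u v| + 1.
Proof.
move=> n4.
have := arcs_bound_or_extremal (@coatom_edge_sym u v) (@coatom_edge_irr u v)
  (@atom_edge_sym u v) (@atom_edge_irr u v) (@coatom_edge_triangle u v)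
  (@connect_coatom_atom u v).
rewrite card_ord arcs_atom_edge arcs_coatom_edge => /(_ n4) [h|[h1 h2]].
  by left; lia.
by right; split; lia.
Qed.

(** * An extremal interval *)

(** Take i to be the least point moved by [w]. All smaller points are fixed, so both the image and
    the preimage of i exceed i. *)
Lemma perm_inversion w : w != 1%g -> exists i j, i < j /\ w j < w i.
Proof.
move=> w1; have /existsP[i0 wi0] : [exists i, w i != i].
  rewrite -negb_forall; apply: contra w1 => /forallP h.
  by apply/eqP/permP => i; rewrite perm1; apply/eqP.
have [i wi imin] := arg_minnP (P := fun i => w i != i) (@nat_of_ord n) wi0.
have fixlt k : k < i -> w k = k.
  by move=> ki; apply/eqP; apply: contraLR ki => wk; rewrite -leqNgt imin.
have iwi : i < w i.
  rewrite ltn_neqAle eq_sym val_eqE wi leqNgt; apply/negP => /fixlt /perm_inj e.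
  by rewrite e eqxx in wi.
pose j := (w^-1)%g i; have wj : w j = i by rewrite permKV.
exists i, j; rewrite wj; split=> //; rewrite ltn_neqAle leqNgt; apply/andP; split.
  by apply: contraNneq wi => /val_inj e; rewrite {1}e wj.
by apply/negP => lt; have := fixlt _ lt; rewrite wj => e; rewrite -e ltnn in lt.
Qed.

Lemma bruhat_le1 w : bruhat_le 1%g w.
Proof.
have [k] := ubnP (perm_length w); elim: k w => // k IH w ltk.
have [->|w1] := eqVneq w 1%g; first exact: connect0.
have [i0 [j0 [ij0 wij0]]] := perm_inversion w1.
pose P := fun p : 'I_n * 'I_n => (p.1 < p.2) && (w p.2 < w p.1).
have P0 : P (i0, j0) by rewrite /P /= ij0.
(* An inversion with the smallest gap between positions: a point strictly between would give an
   inversion (i, m) with a smaller gap. Undoing it is therefore a step down by a cover. *)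
have [[i j] /andP[/= ij wij] pmin] := arg_minnP (fun p : 'I_n * 'I_n => p.2 - p.1) P0.
pose x := (tperm i j * w)%g; have wE : w = (tperm i j * x)%g by rewrite tpermKg.
have len : perm_length w = (perm_length x).+1.
  rewrite wE; apply: length_tperm_cover => //; first by rewrite !permM tpermL tpermR.
  move=> m im mj; rewrite !permM tpermL tpermR.
  rewrite tpermD ?(ltn_ord_neq im) ?(ltn_ord_neq mj) // => h1 h2.
  by have := pmin (i, m); rewrite /P /= im h2 => /(_ isT); lia.
apply: connect_trans (IH x _) (connect1 _); first by lia.
rewrite wE cover_tperm ?(ltn_ord_neq ij) //.
by rewrite -wE len.
Qed.

Lemma card_ord_ltn h : h <= n -> #|[set i : 'I_n | i < h]| = h.
Proof.
move=> hn; rewrite -sum1_card -[RHS]card_ord -sum1_card (big_ord_widen n (fun=> 1) hn).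
by apply: eq_bigl => i; rewrite inE.
Qed.

(** An atom of the identity is an adjacent transposition, since (i j) with a position in between has
    length at least 3. Its first position determines it. *)
Lemma card_atoms1 v : #|atoms 1%g v| <= n.-1.
Proof.
have XP z : z \in atoms 1%g v -> exists i j, i < j /\ z = (tperm i j * 1)%g.
  by rewrite inE => /andP[/coverP[i [j [ij _ -> _]]] _]; exists i, j.
rewrite -(card_tperm_multiples XP); set E := [set p | _].
have adj p : p \in E -> p.2 = p.1.+1 :> nat.
  case: p => i j; rewrite !inE /= => /and3P[ij /(cover_tpermP ij)[_ len] _].
  apply/eqP; rewrite eqn_leq ij andbT leqNgt; apply/negP => lt.
  have in_n : i.+1 < n := leq_ltn_trans ij (ltn_ord j).
  have := @length_tperm_mid 1%g i (Ordinal in_n) j (ltnSn i) lt.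
  by rewrite !perm1 => /(_ (ltnSn i) lt); lia.
rewrite -(@card_ord_ltn n.-1) ?leq_pred //.
rewrite -(card_in_imset (f := fst) (D := mem E)); last first.
  move=> [i j] [k l] /adj /= e1 /adj /= e2 e; congr (_, _) => //.
  by apply: val_inj; rewrite /= e1 e2 e.
apply/subset_leq_card/subsetP => _ /imsetP[p /adj e ->].
by rewrite inE; have := ltn_ord p.2; lia.
Qed.

End Length.

(** The first [h] positions carry the n - h shifted, larger values; here [h] is floor(n/2), and h(n
    - h) = floor(n^2/4). Each pair i < h <= j labels a coatom: a position k between them has v k > v
    i if k < h, and v k < v j otherwise. *)
Lemma many_coatoms n : exists v : 'S_n, n ^ 2 %/ 4 <= #|coatoms 1%g v|.
Proof.
pose h := n./2; have hn : h <= n by rewrite /h; lia.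
(* The default i of [insubd] is never taken, as both branches give a value below n. *)
pose f (i : 'I_n) : 'I_n := insubd i (if i < h then i + (n - h) else i - h).
have fE (i : 'I_n) : f i = (if i < h then i + (n - h) else i - h) :> nat.
  by rewrite val_insubd; have := ltn_ord i; case: ifP => //; case: ifP; lia.
have f_inj : injective f.
  move=> i j /(congr1 (@nat_of_ord n)); rewrite !fE => e; apply: val_inj => /=.
  by have := ltn_ord i; have := ltn_ord j; move: e; case: ifP; case: ifP; lia.
pose v := perm f_inj; exists v.
have vE (i : 'I_n) : v i = (if i < h then i + (n - h) else i - h) :> nat.
  by rewrite permE fE.
pose A := [set i : 'I_n | i < h].
have cA : #|A| = h := card_ord_ltn hn.
have cAC : #|~: A| = n - h by have := cardsC A; rewrite cA card_ord; lia.
have -> : n ^ 2 %/ 4 = #|setX A (~: A)|.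
  rewrite cardsX cA cAC /h.
  by have [k [->|->]] : exists k, n = k.*2 \/ n = k.*2.+1; [exists n./2; lia|nia|nia].
rewrite -(card_in_imset (f := fun p => (tperm p.1 p.2 * v)%g)); last first.
  move=> [i j] [k l]; rewrite !inE /= => /andP[ih jh] /andP[kh lh] /mulIg.
  by apply: tperm_inj_ltn; lia.
apply/subset_leq_card/subsetP => _ /imsetP[[i j] + ->].
rewrite !inE /= => /andP[ih jh].
have ij : i < j by lia.
rewrite bruhat_le1 /=; set w := (tperm i j * v)%g.
have -> : v = (tperm i j * w)%g by rewrite tpermKg.
rewrite cover_tperm ?(ltn_ord_neq ij) //; apply/eqP; apply: length_tperm_cover => //.
  by rewrite !permM tpermL tpermR !vE ih (negPf jh); have := ltn_ord j; lia.
move=> k ik kj; rewrite !permM tpermL tpermR tpermD ?(ltn_ord_neq ik) ?(ltn_ord_neq kj) //.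
by rewrite !vE ih (negPf jh); case: ifP; lia.
Qed.

Theorem theoremB (n : nat) (n_ge4 : 4 <= n) (u v : 'S_n) (le_uv : bruhat_le u v) :
  maximizes_coatoms_minus_atoms u v <->
  #|coatoms u v| = n ^ 2 %/ 4 /\ #|atoms u v| = n.-1.
Proof.
rewrite /maximizes_coatoms_minus_atoms /coatoms_minus_atoms.
have bound u' v' := @coatoms_atoms_bound n u' v' n_ge4.
split=> [maxuv|[-> ->] u' v' _]; last by have := bound u' v'; lia.
(* The interval [1, v0] has difference at least floor(n^2/4) - (n - 1), which excludes the strict
   alternative of [bound] for a maximizer and makes the other two inequalities tight. *)
have [v0 cv0] := many_coatoms n; have av0 := card_atoms1 v0.
have := maxuv 1%g v0 (bruhat_le1 v0); have := bound u v.
lia.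
Qed.
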